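(* For every $\varepsilon>0$ there is a constant $c$ such that for every finite tree $T$ and every list assignment $\{L_v\}_{v\in V(T)}$ with $|L_v|=c$ for all $v$, there is an $x^{2+\varepsilon}$-free coloring of $T$ chosen from $\{L_v\}$.
   Context: For real $r\geq 1$, a finite sequence $s_1\ldots s_N$ is of the form $x^r$ if there is an integer $n\geq 1$ such that $N=\lceil rn\rceil$ and $s_i=s_{i+n}$ for all $1\leq i\leq N-n$ (equivalently, it consists of $\lfloor r\rfloor$ copies of a block $x=s_1\ldots s_n$ followed by the prefix of $x$ of length $\lceil \mathrm{frac}(r)\, n\rceil$, where $\mathrm{frac}(r)$ is the fractional part of $r$); e.g. $abcdabcdab$ is of the form $x^{2.5}$. For real $r>1$, a coloring of the vertices of a graph $G$ is $x^r$-free if no simple path of $G$ has a color sequence containing a block of consecutive terms of the form $x^r$. A list assignment is a family $\{L_v\}$ of sets of colors, and a coloring $f$ is chosen from it if $f(v)\in L_v$ for every vertex $v$. *)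

(* Defs.v *)
From mathcomp Require Import all_boot all_order all_algebra.
From mathcomp Require Import finmap reals.

Set Implicit Arguments.
Unset Strict Implicit.
Unset Printing Implicit Defensive.

Import Order.TTheory GRing.Theory Num.Theory.
Local Open Scope ring_scope.

Definition simple_graph (V : finType) (e : rel V) : Prop :=
  symmetric e /\ irreflexive e.

(* [ucycle e s] also holds for a single edge traversed back and forth
   (size 2), and for [s = [::]]; genuine graph cycles have size at least 3. *)
Definition acyclic (V : finType) (e : rel V) : Prop :=
  forall s : seq V, (2 < size s)%N -> ~ ucycle e s.

Definition is_tree (V : finType) (e : rel V) : Prop :=
  [/\ simple_graph e, forall x y : V, connect e x y & acyclic e].

(* [s] is of the form x^r: indices are shifted to start at 0, so the range
   1 <= i <= N - n of the usual definition reads i + n < N here. *)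
Definition power_form (R : realType) (r : R) (C : Type) (s : seq C) : Prop :=
  exists n : nat,
    [/\ (1 <= n)%N,
        (size s)%:Z = Num.ceil (r * n%:R) &
        forall i : nat, (i + n < size s)%N -> onth s i = onth s (i + n)%N].

Definition simple_path (V : finType) (e : rel V) (x : V) (p : seq V) : Prop :=
  path e x p /\ uniq (x :: p).

Definition power_free_coloring (R : realType) (r : R) (V : finType)
    (e : rel V) (C : eqType) (f : V -> C) : Prop :=
  forall (x : V) (p : seq V), simple_path e x p ->
  forall t : seq C, infix t (map f (x :: p)) -> ~ power_form r t.

(* Main.v *)
Require Import Defs.
From mathcomp Require Import all_boot all_order all_algebra.
From mathcomp Require Import finmap reals.
From mathcomp Require Import zify ring lra.

Import Order.TTheory GRing.Theory Num.Theory.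
Local Open Scope ring_scope.

(** Root the tree and colour it from the root downwards.  The top vertex of a
    simple path cuts it into two vertical legs, one of which contains more than
    half of its vertices; so a path of the form [x^(2+eps)] with period [n] has
    a vertical leg on which at least [eps n / 2] consecutive colours agree with
    those [n] steps further up.  Such agreements are avoided greedily.  Let
    [j_n] be the length of the current agreement at distance [n], let
    [m_n = ceil (n / K)] with [K >= 2 / eps], and consider the potential
    [sum_n lam ^ (j_n - m_n)].  A new colour extends the agreement at distance
    [n] for one choice only and resets it to [0] otherwise.  Averaged over a
    list of [2 lam] colours, the new potential is therefore at most half the old
    one plus [sum_n lam ^ (- m_n) < 1 / 2], so some colour keeps it below [1],
    whereas [j_n >= m_n] would force it to be at least [1]. *)

(** * Rooted trees *)

(** If the paths leave [x] by different edges, the first vertex [z] of one that lies on the other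
    closes a cycle through [x]. *)
Lemma acyclic_simple_path_inj {V : finType} {e : rel V} {x : V} {p q : seq V} :
  symmetric e -> acyclic e -> simple_path e x p -> simple_path e x q ->
  last x p = last x q -> p = q.
Proof.
move=> esym eacy; elim: p x q => [|a p IH] x q [pp up] [pq uq] /= el.
  case: q pq uq el => [//|b q] _ /= /andP[xq _] el.
  by move: xq; rewrite el mem_last.
case: q pq uq el => [|b q] pq uq el.
  by have := mem_last a p; rewrite el => xp; move: up; rewrite cons_uniq xp.
have [eab|neab] := eqVneq a b.
  subst b; congr cons; apply: IH el.
    by move: pp up => /= /andP[_ ?] /andP[_ ?].
  by move: pq uq => /= /andP[_ ?] /andP[_ ?].
have hz : has (mem (b :: q)) (a :: p).
  by apply/hasP; exists (last a p); [exact: mem_last|rewrite el; exact: (mem_last b q)].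
have ha : head x (a :: p) = a by [].
have hb : head x (b :: q) = b by [].
move: hz ha hb up pp neab uq pq; move: {el IH} (a :: p) (b :: q) => P Q hz ha hb.
move: ha; case: (split_find hz) => z p1 p2 zQ Dp1 ha up pp neab uq pq.
case/splitPr: (zQ : z \in Q) hb Dp1 uq pq => q1 q2 hb Dp1 uq pq.
case: (eacy (x :: p1 ++ z :: rev q1)).
  rewrite /= size_cat /= size_rev.
  case: p1 ha {up pp Dp1} => [|? ?] /= ha; last by lia.
  case: q1 hb {uq pq} => [|? ?] /= hb; last by lia.
  by rewrite -ha -hb eqxx in neab.
apply/andP; split.
  rewrite /= rcons_cat /= cat_path /=.
  move: pp; rewrite cat_path (rcons_path _ _ p1) => /andP[/andP[-> ->] _] /=.
  move: pq; rewrite cat_path /= => /and3P[pq1 eq1z _].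
  have := rev_path e x (rcons q1 z).
  rewrite last_rcons belast_rcons rev_cons => ->.
  rewrite (eq_path (e' := e)); last by move=> ? ?; rewrite /= esym.
  by rewrite rcons_path pq1 eq1z.
move: up uq; rewrite /= !cat_uniq !mem_cat /= !mem_rcons !inE !mem_rev !rev_uniq.
rewrite !negb_or rcons_uniq => /andP[/andP[/andP[-> xp] _]].
move=> /and3P[/andP[zp1 ->] _ _] /andP[/and3P[-> _ _]].
rewrite zp1 => /and3P[-> /andP[zq _] _]; rewrite xp zq !andbT /=.
apply/hasPn => y; rewrite mem_rev => yq1; apply: contra Dp1 => yp1.
by apply/hasP; exists y; rewrite //= mem_cat yq1.
Qed.

(* [anc v] lists [v], its parent, and so on up to the root. *)
Definition ancestry {V : finType} (e : rel V) (anc : V -> seq V) : Prop :=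
  [/\ forall v, exists s, anc v = v :: s,
      forall v s z t, anc v = s ++ z :: t -> anc z = z :: t &
      forall u v, e u v -> anc v = v :: anc u \/ anc u = u :: anc v].

(** Take for [anc v] the reversal of the simple path from [r] to [v], which is unique by
    acyclicity. *)
Lemma tree_ancestry {V : finType} {e : rel V} (r : V) :
  is_tree e -> exists anc, ancestry e anc.
Proof.
move=> [[esym eirr] econ eacy].
have /fin_all_exists[P HP] v : exists p, simple_path e r p /\ last r p = v.
  case/connectP: (econ r v) => p pp ->.
  by case: (shortenP pp) => q pq uq _; exists q.
have Puniq v p : simple_path e r p -> last r p = v -> P v = p.
  move=> sp lp; have [sPv lPv] := HP v.
  by apply: (acyclic_simple_path_inj esym eacy sPv sp); rewrite lp.
have ancE v s z t : rev (r :: P v) = s ++ z :: t -> rev (r :: P z) = z :: t.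
  move=> /(congr1 rev); rewrite revK rev_cat rev_cons.
  case E : (rcons (rev t) z) => [|a p1]; first by case: (rev t) E.
  case=> ra EP; subst a.
  have [[pp up] _] := HP v.
  rewrite (Puniq z p1).
  - by rewrite -E rev_rcons revK.
  - by move: pp up; rewrite EP cat_path -cat_cons cat_uniq
       => /andP[pp1 _] /andP[up1 _]; split.
  - by rewrite -[LHS]/(last r (r :: p1)) -E last_rcons.
exists (fun v => rev (r :: P v)); split => //.
  move=> v; have [_ lv] := HP v; rewrite lastI lv rev_rcons.
  by eexists.
move=> u v euv; have [[pu uu] lu] := HP u.
have [vP|vP] := boolP (v \in r :: P u); last first.
  left; rewrite (Puniq v (rcons (P u) v)).
  - by rewrite -rcons_cons rev_rcons.
  - split; first by rewrite rcons_path pu lu.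
    by rewrite -rcons_cons rcons_uniq vP.
  - by rewrite last_rcons.
right; case/splitPr E : _ / vP => [p1 p2].
have lpu : last v p2 = u by rewrite -lu -[LHS](last_cat v p1 (v :: p2)) -E.
have upu : uniq (v :: p2) by move: uu; rewrite E cat_uniq => /and3P[].
have ppu : path e v p2.
  move: pu; case: p1 E => [|a p1] /=; first by case=> -> ->.
  by case=> _ ->; rewrite cat_path /= => /and3P[].
(* The edge from [u] to [v] closes the stretch from [v] to [u] into a cycle unless that stretch is a
   single edge, so [v] is the parent of [u]. *)
have sp2 : ~~ (2 < size (v :: p2))%N.
  apply/negP => /eacy; apply; apply/andP; split=> //.
  by rewrite /= rcons_path ppu lpu.
case: p2 lpu upu ppu sp2 E => [|w [|//]] /=.
  by move=> vu; rewrite vu eirr in euv.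
move=> -> _ _ _ E.
have Er : rev (r :: P u) = [:: u] ++ v :: rev p1.
  by rewrite E rev_cat !rev_cons.
by rewrite (ancE _ _ _ _ Er) -E Er.
Qed.

(** The index [i] is the position of the top vertex, which belongs to both legs. *)
Lemma simple_path_legs {V : finType} {e : rel V} {anc : V -> seq V} {x : V} {p : seq V} :
  ancestry e anc -> simple_path e x p ->
  exists i, [/\ (i <= size p)%N, prefix (take i.+1 (x :: p)) (anc x) &
                prefix (rev (drop i (x :: p))) (anc (last x p))].
Proof.
move=> [anc1 ancE ance]; elim: p x => [|z p IH] x [pp up].
  by exists 0%N; have [s ->] := anc1 x; rewrite /= eqxx prefix0s.
have [|i [ip pre1 pre2]] := IH z.
  by move: pp up => /= /andP[_ ?] /andP[_ ?].
have /andP[exz _] := pp.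
case: (ance x z exz) => E; last first.
  by exists i.+1; split=> //; rewrite E [take _ _]/= prefix_cons eqxx.
(* Here [x] is the parent of [z]; a rest that climbed from [z] would return to [x], so it only
   descends. *)
have i0 : i = 0%N.
  case: i ip pre1 {pre2} => [//|i]; case: p pp up {IH} => [//|w p] _ up _.
  have [s Es] := anc1 x.
  rewrite E Es /= eqxx /= => /andP[/eqP wx _].
  by move: up; rewrite wx /= !inE eqxx orbT.
subst i; exists 0%N; split=> //.
  by have [s ->] := anc1 x; rewrite /= eqxx prefix0s.
move: pre2; rewrite !drop0 /= => /prefixP[t Et].
rewrite rev_cons cat_rcons in Et.
have := ancE _ _ _ _ Et; rewrite E => -[Ex].
have [s Es] := anc1 x.
by apply/prefixP; exists s; rewrite Et -Ex Es !rev_cons !cat_rcons.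
Qed.

(** * The potential *)

Fixpoint common_prefix_length {C : eqType} (s t : seq C) : nat :=
  match s, t with
  | x :: s', y :: t' => if x == y then (common_prefix_length s' t').+1 else 0
  | _, _ => 0
  end.

Lemma common_prefix_length_ge {C : eqType} (x0 : C) (l : nat) (s t : seq C) :
  (l <= size s)%N -> (l <= size t)%N ->
  (forall i, (i < l)%N -> nth x0 s i = nth x0 t i) ->
  (l <= common_prefix_length s t)%N.
Proof.
elim: l s t => [//|l IH] [//|x s] [//|y t] ls lt H.
have /= -> := H 0%N isT; rewrite eqxx ltnS.
by apply: IH => // i il; apply: (H i.+1).
Qed.

(* Colour histories are listed most recent first, so [common_prefix_length] is
   the length of the current agreement at distance [k.+1]; the exponent
   [(k %/ K).+1] is [ceil (k.+1 / K)]. *)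
Definition potential (F : realFieldType) (K N : nat) {C : eqType} (h : seq C) : F :=
  \sum_(k < N) (K.*2.+2)%:R ^+ common_prefix_length h (drop k.+1 h)
               / (K.*2.+2)%:R ^+ (k %/ K).+1.

(** Each exponent occurs for at most [K] indices, so a geometric series bounds the sum by
    [K / (lam - 1)], and [lam = 2K + 2] makes this [K / (2K + 1)]. *)
Lemma potential_nil (F : realFieldType) (K N : nat) (C : eqType) :
  (0 < K)%N -> potential F K N ([::] : seq C) < 2^-1.
Proof.
move=> K0; set lam : F := (K.*2.+2)%:R.
have lamE : lam = 2 * K%:R + 2 by rewrite /lam -addn2 natrD -mul2n natrM.
have KF : 0 < K%:R :> F by rewrite ltr0n.
have lam0 : 0 < lam by rewrite lamE; lra.
have blocks M : \sum_(0 <= k < M * K) lam ^- (k %/ K).+1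
    = K%:R / (lam - 1) * (1 - lam ^- M).
  elim: M => [|M IH]; first by rewrite mul0n big_geq // expr0 invr1 subrr mulr0.
  rewrite (big_cat_nat (n := M * K)) ?leq_mul2r ?leqnSn ?orbT //= IH.
  rewrite (@eq_big_nat _ _ _ _ _ _ (fun=> lam ^- M.+1)); last first.
    move=> k /andP[lek ltk]; suff -> : (k %/ K = M)%N by [].
    by apply/eqP; rewrite eqn_leq -ltnS ltn_divLR // ltk leq_divRL.
  rewrite sumr_const_nat mulSn addnK -[_ *+ K]mulr_natr exprS.
  have lamM : lam ^+ M != 0 by rewrite expf_neq0 // gt_eqF.
  by rewrite lamE in lamM *; field; rewrite lamM; apply/andP; split; lra.
apply: (@le_lt_trans _ _ (\sum_(0 <= k < N * K) lam ^- (k %/ K).+1)).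
  rewrite (big_cat_nat (n := N)) ?leq_pmulr //= big_mkord.
  rewrite [leRHS]addrC -[leLHS]add0r lerD //.
    by apply: sumr_ge0 => k _; rewrite invr_ge0 exprn_ge0 // ltW.
  by apply: ler_sum => k _; rewrite expr0 mul1r.
rewrite blocks.
have H1 : 0 < K%:R / (lam - 1) by rewrite divr_gt0 // lamE; lra.
have H2 : 0 < lam ^- N by rewrite invr_gt0 exprn_gt0.
have H3 : K%:R / (lam - 1) < 2^-1 by rewrite ltr_pdivrMr lamE; lra.
by nra.
Qed.

Lemma potential_cons (F : realFieldType) (K N : nat) {C : choiceType}
    (h : seq C) (A : {fset C}) :
  (0 < K)%N -> #|` A|%fset = (K.*2.+2).*2 -> potential F K N h < 1 ->
  exists2 x, x \in A & potential F K N (x :: h) < 1.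
Proof.
move=> K0 cA; rewrite /potential; set lam : F := (K.*2.+2)%:R => hh.
have lam0 : 0 < lam by rewrite ltr0n.
case: (boolP (has (fun x => potential F K N (x :: h) < 1) A)) => [/hasP[x]|/hasPn H].
  by exists x.
pose S : F := potential F K N ([::] : seq C).
have S2 : S < 2^-1 := potential_nil F K N C K0.
(* At each index every colour is charged the reset value; the only colour that can extend the
   agreement is also charged [lam] times the old term. *)
have : \sum_(x <- A) potential F K N (x :: h) <= \sum_(x <- A) S + lam * potential F K N h.
  rewrite /S /potential [X in _ <= X + _]exchange_big /= exchange_big /=.
  rewrite mulr_sumr -big_split /=.
  apply: ler_sum => k _; rewrite -!mulr_suml mulrA -mulrDl.
  rewrite ler_wpM2r ?invr_ge0 ?exprn_ge0 ?(ltW lam0) //= -/lam.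
  case E: (drop k h) => [|y t].
    by rewrite lerDl mulr_ge0 ?exprn_ge0 // ltW.
  have -> : drop k.+1 h = t by rewrite -add1n -drop_drop E /= drop0.
  set j := common_prefix_length h t.
  apply: (@le_trans _ _ (\sum_(x <- A) (1 + (if x == y then lam ^+ j.+1 else 0)))).
    apply: ler_sum => x _; case: eqP => _; rewrite ?addr0 // lerDr //.
  rewrite big_split /= lerD2l -big_mkcond /= -exprS.
  have [yA|yA] := boolP (y \in A).
    by rewrite -big_filter filter_pred1_uniq // big_seq1.
  rewrite big_seq_cond big1 ?exprn_ge0 ?(ltW lam0) // => x /andP[xA /eqP xy].
  by rewrite -xy xA in yA.
rewrite big_const_seq count_predT iter_addr_0.
have cR : (size A)%:R = 2 * lam :> F by rewrite [size A]cA -mul2n natrM.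
(* If every colour failed, the sum would be at least [2 * lam], but the bound above is less than
   [lam + lam]. *)
have : \sum_(x <- A) (1 : F) <= \sum_(x <- A) potential F K N (x :: h).
  by rewrite big_seq [leRHS]big_seq; apply: ler_sum => x /H; rewrite -leNgt.
rewrite big_const_seq count_predT iter_addr_0 -[S *+ _]mulr_natr cR.
rewrite -/(potential F K N h) in hh => H1.
by move=> H2; exfalso; clear K0 cA; nra.
Qed.

(** Otherwise the agreement at distance [n] reaches [ceil (n / K)], and its term alone is at least
    [1]. *)
Lemma potential_period {F : realFieldType} {K N : nat} {C : eqType} (x0 : C)
    {h s : seq C} {n : nat} :
  (0 < K)%N -> (0 < n <= N)%N -> potential F K N h < 1 -> prefix s h ->
  (forall i, (i + n < size s)%N -> nth x0 s i = nth x0 s (i + n)%N) ->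
  ((size s - n) * K < n)%N.
Proof.
move=> K0 /andP[n0 nN] hh /prefixP[t Et] per; rewrite ltnNge; apply/negP => le.
case: n n0 nN per le => [//|n] _ nN per le.
set lam : F := (K.*2.+2)%:R.
have lam1 : 1 <= lam by rewrite ler1n.
have lam0 : 0 < lam by apply: lt_le_trans lam1.
have jge : ((n %/ K).+1 <= common_prefix_length h (drop n.+1 h))%N.
  apply: (@leq_trans (size s - n.+1)); first by rewrite ltn_divLR.
  apply: (@common_prefix_length_ge _ x0); rewrite Et ?size_drop ?size_cat; [lia..|].
  move=> i il; have lti : (i + n.+1 < size s)%N by lia.
  by rewrite nth_drop !nth_cat addnC lti per // (leq_ltn_trans _ lti) // leq_addr.
move: hh; rewrite ltNge => /negP; apply.
rewrite /potential (bigD1 (Ordinal nN)) //= -[leLHS]addr0 lerD //.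
  by rewrite ler_pdivlMr ?exprn_gt0 // mul1r ler_weXn2l.
by apply: sumr_ge0 => k _; rewrite divr_ge0 ?exprn_ge0 // ltW.
Qed.

(** * The coloring *)

(** The greedy choice at [v] depends only on the colours above it, so it is computed by a fold along
    [anc v]; colours of common ancestors are consistent because every tail of [anc v] is the
    ancestry of its own head. *)
Lemma ancestry_coloring (F : realFieldType) (K : nat) (V : finType) (e : rel V)
    (anc : V -> seq V) (C : choiceType) (L : V -> {fset C}) :
  (0 < K)%N -> ancestry e anc -> (forall v, #|` L v|%fset = (K.*2.+2).*2) -> V ->
  exists f : V -> C, forall v,
    f v \in L v /\ potential F K #|V| (map f (anc v)) < 1.
Proof.
move=> K0 [anc1 ancE _] cL r.
(* A default only: by [potential_cons] the filtered list below is nonempty whenever the history has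
   potential below [1]. *)
have [x0 _] : exists x0, x0 \in L r by apply/fset0Pn; rewrite -cardfs_gt0 cL.
pose good (h : seq C) (x : C) := potential F K #|V| (x :: h) < 1.
pose next h (v : V) := head x0 (filter (good h) (L v)).
pose hist := foldr (fun v h => next h v :: h) [::].
have nextP h v : potential F K #|V| h < 1 -> (next h v \in L v) && good h (next h v).
  move=> /(potential_cons _ _ _ _ _ K0 (cL v))[x xL gx].
  have : x \in filter (good h) (L v) by rewrite mem_filter /good gx.
  rewrite /next; case E: (filter _ _) => [//|y s] _ /=.
  have : y \in filter (good h) (L v) by rewrite E mem_head.
  by rewrite mem_filter andbC.
have histP s : potential F K #|V| (hist s) < 1.
  elim: s => [|v s IH] /=; last by have /andP[] := nextP _ v IH.
  by apply: (lt_trans (potential_nil F K #|V| C K0)); lra.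
pose f v := head x0 (hist (anc v)).
have fE s v u : anc v = u ++ s -> map f s = hist s.
  elim: s u => [//|w s IH] u Ev /=.
  rewrite (IH (rcons u w)) ?cat_rcons //.
  by rewrite /f (ancE _ _ _ _ Ev).
exists f => v; split; last by rewrite (fE _ v [::]).
have [s Es] := anc1 v; rewrite /f Es /=.
by have /andP[] := nextP _ v (histP s).
Qed.

Local Open Scope fset_scope.

Theorem theorem5 (R : realType) (eps : R) (heps : 0 < eps) :
  exists c : nat,
    forall (V : finType) (e : rel V) (C : choiceType) (L : V -> {fset C}),
      is_tree e ->
      (forall v : V, #|` L v| = c) ->
      exists f : V -> C,
        (forall v : V, f v \in L v) /\ power_free_coloring (2 + eps) e f.
Proof.
have [K epsK] : exists K : nat, 2 / eps < K%:R.
  by exists (Num.bound (2 / eps)); apply: archi_boundP; rewrite divr_ge0 // ltW.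
have K0 : (0 < K)%N by rewrite -(ltr0n R); apply: le_lt_trans epsK; rewrite divr_ge0 // ltW.
exists (K.*2.+2).*2 => V e C L treeV cL.
case: (pickP (@predT V)) => [r _|V0]; last first.
  have noV (v : V) : False by have := V0 v.
  by exists (fun v => False_rect C (noV v)); split => v; case: (noV v).
have [anc Hanc] := tree_ancestry r treeV.
have [f fP] := ancestry_coloring R _ _ _ _ _ _ K0 Hanc cL r.
exists f; split=> [v|x p [pp up] t /infixP[s1 [s2 Et]] [n [n0 sn per]]].
  by have [] := fP v.
have nt : (2 + eps) * n%:R <= (size t)%:R.
  by have := ceil_ge ((2 + eps) * n%:R); rewrite -sn.
pose x0 := f r.
have {}per j : (j + n < size t)%N -> nth x0 t j = nth x0 t (j + n)%N.
  by move=> /per; rewrite -!odflt_onth => ->.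
have nR : 0 < n%:R :> R by rewrite ltr0n.
have [y [q [sq Eq]]] : exists y q, simple_path e y q /\ t = map f (y :: q).
  pose w := take (size t) (drop (size s1) (x :: p)).
  have Ew : map f w = t by rewrite map_take map_drop Et drop_size_cat // take_size_cat.
  have uw : uniq w by rewrite take_uniq // drop_uniq.
  have sw : sorted e w by rewrite take_sorted // drop_sorted.
  move: Ew uw sw; case: w => [/= t0|y q /= <- uq pq]; last by exists y, q.
  by move: nt; rewrite -t0 /=; nra.
have map_prefix (a b : seq V) : prefix a b -> prefix (map f a) (map f b).
  by move=> /prefixP[c ->]; rewrite map_cat prefix_prefix.
have szt : size t = (size q).+1 by rewrite Eq size_map.
have [i [iq pre1 pre2]] := simple_path_legs Hanc sq.
(* The potential tracks all distances up to [#|V|], and no simple path has more vertices. *)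
have nV : (0 < n <= #|V|)%N.
  rewrite n0 /= (@leq_trans (size t)) //.
    by rewrite -(ler_nat R); nra.
  by rewrite szt -[(size q).+1]/(size (y :: q)) -(card_uniqP _) ?max_card //; case: sq.
(* A leg longer than half of [t] would exceed [n] by more than [eps * n / 2], hence by more than
   [n / K], against [potential_period]. *)
have short v s : prefix s (map f (anc v)) ->
    (forall i, (i + n < size s)%N -> nth x0 s i = nth x0 s (i + n)%N) ->
    (size s).*2%:R <= (size t)%:R :> R.
  move=> pre pers; have [_ pot] := fP v.
  have := potential_period x0 K0 nV pot pre pers.
  rewrite leNgt => H; apply/negP => H2.
  have H3 : (n <= size s)%N by rewrite -(ler_nat R); move: H2; rewrite -mul2n natrM; nra.
  move: H; rewrite -(ltr_nat R) natrM natrB // => H.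
  move: H2 epsK; rewrite -mul2n natrM ltr_pdivrMr // => H2 epsK.
  have KR : 0 < K%:R :> R by rewrite ltr0n.
  have : eps * n%:R < 2 * ((size s)%:R - n%:R) by lra.
  nra.
have l1 : ((size (take i.+1 t)).*2 <= size t)%N.
  rewrite -(ler_nat R); apply: (short y).
    by rewrite Eq -map_take; apply: map_prefix.
  move=> j; rewrite size_takel ?szt // => jl.
  by rewrite !nth_take; [apply: per; rewrite szt|..]; lia.
(* The descending leg is read upwards from its lower end; a period survives reversal. *)
have l2 : ((size (rev (drop i t))).*2 <= size t)%N.
  rewrite -(ler_nat R); apply: (short (last y q)).
    by rewrite Eq -map_drop -map_rev; apply: map_prefix.
  move=> j; rewrite size_rev size_drop szt => jl.
  rewrite !nth_rev ?size_drop ?szt; [|lia..].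
  by rewrite !nth_drop [RHS]per ?szt; [congr nth|]; lia.
(* The legs share the top vertex, so their sizes add up to [size t + 1] and cannot both be at most
   half of [size t]. *)
move: l1 l2; rewrite size_rev size_drop size_takel szt //; lia.
Qed.
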